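(* Let $K=\mathbb{Q}(\sqrt{p},\sqrt{q})$ be a real biquadratic field, where $p,q>1$ are distinct squarefree integers, and let $\mathcal{O}_K$ be its ring of integers. Then there does not exist a $\mathbb{Z}$-form that is universal over $\mathcal{O}_K$.
   Context: A $\mathbb{Z}$-form is a positive definite quadratic form $Q(x_1,\dots,x_r)=\sum_{1\le i\le j\le r}a_{ij}x_ix_j$ with all $a_{ij}\in\mathbb{Z}$. An element of $\mathcal{O}_K$ is totally positive if its image under each of the four real embeddings of $K$ is positive. A $\mathbb{Z}$-form $Q$ is universal over $\mathcal{O}_K$ if every totally positive $\alpha\in\mathcal{O}_K$ equals $Q(v)$ for some $v\in\mathcal{O}_K^r$. *)

(* Defs.v *)
From HB Require Import structures.
From mathcomp Require Import all_boot all_order all_algebra all_field.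
Set Implicit Arguments. Unset Strict Implicit. Unset Printing Implicit Defensive.
Import Order.TTheory GRing.Theory Num.Theory.
Local Open Scope ring_scope.

Definition squarefreen (n : nat) : Prop := forall d : nat, (d * d %| n)%N -> d = 1%N.

(* The element a + b sqrt p + c sqrt q + d sqrt p sqrt q, transported by the
   real embedding sqrt p |-> (-1)^s sqrt p, sqrt q |-> (-1)^t sqrt q.
   With s = t = false this is the element itself (K viewed inside algC). *)
Definition bqelt (p q : nat) (s t : bool) (a b c d : rat) : algC :=
  ratr a + (-1) ^+ s * ratr b * sqrtC p%:R + (-1) ^+ t * ratr c * sqrtC q%:R
  + (-1) ^+ s * (-1) ^+ t * ratr d * (sqrtC p%:R * sqrtC q%:R).

Definition inK (p q : nat) (x : algC) : Prop :=
  exists a b c d : rat, x = bqelt p q false false a b c d.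

Definition inOK (p q : nat) (x : algC) : Prop := inK p q x /\ x \in Aint.

Definition totpos (p q : nat) (x : algC) : Prop :=
  exists a b c d : rat, x = bqelt p q false false a b c d /\
    forall s t : bool, 0 < bqelt p q s t a b c d.

Definition Zform_eval (r : nat) (A : 'I_r -> 'I_r -> int) (x : 'I_r -> algC) : algC :=
  \sum_(i < r) \sum_(j < r | (i <= j)%N) (A i j)%:~R * x i * x j.

Definition posdef (r : nat) (A : 'I_r -> 'I_r -> int) : Prop :=
  forall x : 'I_r -> algC, (forall i, x i \is Num.real) -> (exists i, x i != 0) ->
    0 < Zform_eval A x.

Definition universal_OK (p q r : nat) (A : 'I_r -> 'I_r -> int) : Prop :=
  forall alpha : algC, inOK p q alpha -> totpos p q alpha ->
    exists v : 'I_r -> algC, (forall i, inOK p q (v i)) /\ Zform_eval A v = alpha.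

(* Main.v *)
(** Write [K] as the set of [a + b sqrt(x y) + c sqrt(x z) + e sqrt(y z)] with [x, y, z]
    pairwise coprime (a permutation of [g, p / g, q / g] for [g = gcd p q]) and put [d = x y].
    Take [alpha = (n + t + sqrt d) / t], where [t = 2] and [n] is odd if [d = 1 mod 4], [t = 1]
    otherwise, and [n^2 < d < (n + t)^2].  Apply to [Q v = alpha] the functional
    [1 |-> 1], [sqrt d |-> - n], extended by [0] to [K].  Its value at [alpha] is [1], so
      [Q (a - n b) + (d - n^2) Q b + z H = 1],  [H = x Q c + y Q e - n P(c, e) >= 0],
    with [P] the polar form of [Q].  Integrality of [v] makes [4 H] an integer, so [z >= 5]
    forces [H = 0], hence [c = e = 0].  The two other terms are then nonnegative integers, and
    either choice of the vanishing one contradicts the coefficient of [sqrt d] in [Q v = alpha],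
    unless [d = 5].  With [x < y < z] this covers everything but [x y = 5], where [y] and [z]
    are exchanged, and [Q(sqrt 2, sqrt 3)], where even [2 H] is an integer. *)

Require Import Defs.
From mathcomp Require Import all_boot all_order all_algebra all_field.
From mathcomp Require Import ring lra zify.
Set Implicit Arguments. Unset Strict Implicit. Unset Printing Implicit Defensive.
Import Order.TTheory GRing.Theory Num.Theory.
Local Open Scope ring_scope.

(** * Quadratic forms and their polar forms *)

Definition qform (R : comNzRingType) r (A : 'I_r -> 'I_r -> int) (u : 'I_r -> R) : R :=
  \sum_(i < r) \sum_(j < r | (i <= j)%N) (A i j)%:~R * (u i * u j).

Definition polar (R : comNzRingType) r (A : 'I_r -> 'I_r -> int) (u w : 'I_r -> R) : R :=
  \sum_(i < r) \sum_(j < r | (i <= j)%N) (A i j)%:~R * (u i * w j + w i * u j).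

Lemma qform_lin (R : comNzRingType) r (A : 'I_r -> 'I_r -> int) (k l : R) (u w : 'I_r -> R) :
  qform A (fun i => k * u i + l * w i) =
  k ^+ 2 * qform A u + l ^+ 2 * qform A w + k * l * polar A u w.
Proof.
rewrite /qform /polar !mulr_sumr -!big_split; apply: eq_bigr => i _ /=.
by rewrite !mulr_sumr -!big_split; apply: eq_bigr => j _ /=; ring.
Qed.

Lemma polar_lin (R : comNzRingType) r (A : 'I_r -> 'I_r -> int) (k l : R) (u v w : 'I_r -> R) :
  polar A (fun i => k * u i + l * v i) w = k * polar A u w + l * polar A v w.
Proof.
rewrite /polar !mulr_sumr -!big_split; apply: eq_bigr => i _ /=.
by rewrite !mulr_sumr -!big_split; apply: eq_bigr => j _ /=; ring.
Qed.

Lemma polarxx (R : comNzRingType) r (A : 'I_r -> 'I_r -> int) (u : 'I_r -> R) :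
  polar A u u = 2 * qform A u.
Proof.
rewrite /qform mulr_sumr; apply: eq_bigr => i _; rewrite mulr_sumr.
by apply: eq_bigr => j _; ring.
Qed.

Lemma eq_qform (R : comNzRingType) r (A : 'I_r -> 'I_r -> int) (u w : 'I_r -> R) :
  u =1 w -> qform A u = qform A w.
Proof. by move=> e; apply: eq_bigr => i _; apply: eq_bigr => j _; rewrite !e. Qed.

Lemma eq_polar (R : comNzRingType) r (A : 'I_r -> 'I_r -> int) (u v w : 'I_r -> R) :
  u =1 v -> polar A u w = polar A v w.
Proof. by move=> e; apply: eq_bigr => i _; apply: eq_bigr => j _; rewrite !e. Qed.

Lemma qform_int r (A : 'I_r -> 'I_r -> int) (u : 'I_r -> rat) :
  (forall i, u i \is a Num.int) -> qform A u \is a Num.int.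
Proof. by move=> h; do 2![apply: rpred_sum => ? _]; rewrite !rpredM ?rpred_int. Qed.

Lemma polar_int r (A : 'I_r -> 'I_r -> int) (u w : 'I_r -> rat) :
  (forall i, u i \is a Num.int) -> (forall i, w i \is a Num.int) ->
  polar A u w \is a Num.int.
Proof.
move=> hu hw; do 2![apply: rpred_sum => ? _].
by rewrite rpredM ?rpred_int // rpredD // rpredM.
Qed.

Lemma qform_gt0 r (A : 'I_r -> 'I_r -> int) (u : 'I_r -> rat) :
  posdef A -> (exists i, u i != 0) -> 0 < qform A u.
Proof.
move=> pA [i ui].
have := pA (fun i => ratr (u i)).
have -> : Zform_eval A (fun i => ratr (u i)) = ratr (qform A u).
  rewrite /qform rmorph_sum; apply: eq_bigr => k _; rewrite rmorph_sum.
  by apply: eq_bigr => j _ /=; rewrite !rmorphM /= ratr_int mulrA.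
rewrite ltr0q; apply; last by exists i; rewrite fmorph_eq0.
by move=> k; apply: Creal_Crat; apply: Crat_rat.
Qed.

Lemma qform_ge0 r (A : 'I_r -> 'I_r -> int) (u : 'I_r -> rat) :
  posdef A -> 0 <= qform A u.
Proof.
move=> pA; case: (boolP [exists i, u i != 0]) => [/existsP h|/existsPn h].
  by rewrite ltW ?qform_gt0.
rewrite /qform big1 // => i _; rewrite big1 // => j _.
by move: (h i) => /negPn/eqP ->; rewrite mul0r mulr0.
Qed.

Lemma qform_eq0 r (A : 'I_r -> 'I_r -> int) (u : 'I_r -> rat) :
  posdef A -> qform A u = 0 -> forall i, u i = 0.
Proof.
move=> pA q0 i; apply/eqP/negPn/negP => ui.
by have := @qform_gt0 _ _ u pA (ex_intro _ i ui); rewrite q0 ltxx.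
Qed.

Lemma rat_int_gt0_ge1 (a : rat) : a \is a Num.int -> 0 < a -> 1 <= a.
Proof. by move=> /intrP[m ->]; rewrite ltr0z ler1z. Qed.

(* Applying the functional [1 |-> 1, sqrt (x y) |-> - n] to [Q(v) = alpha]
   turns the hypotheses on the two coefficients into
   [Q (a - n b) + (x y - n^2) Q b + z H = 1] with all terms nonnegative. *)
Lemma no_representation r (A : 'I_r -> 'I_r -> int) (x y z n t k : rat) (a b c e : 'I_r -> rat) :
    posdef A -> 0 < x -> 0 < t -> 0 < k -> k < z -> n ^+ 2 < x * y ->
    (x * y - n ^+ 2) / t ^+ 2 \is a Num.int ->
    ~ (2 * n = t /\ x * y = n ^+ 2 + t ^+ 2) ->
    k * (x * qform A c + y * qform A e - n * polar A c e) \is a Num.int ->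
    ((forall i, c i = 0) -> (forall i, e i = 0) ->
      forall i, t * b i \is a Num.int /\ a i - n * b i \is a Num.int) ->
    qform A a + x * y * qform A b + z * (x * qform A c + y * qform A e) = (n + t) / t ->
    polar A a b + z * polar A c e = t^-1 ->
  False.
Proof.
move=> pA x0 t0 k0 kz dn dint dne Hint abint e1 e2.
set H := x * qform A c + y * qform A e - n * polar A c e in Hint.
(* Completing the square in [c] shows [H >= 0], and shows that [H = 0] forces first [e = 0] and then
   [c = 0]. *)
have HE : x * H = qform A (fun i => x * c i + (- n) * e i) + (x * y - n ^+ 2) * qform A e.
  by rewrite qform_lin /H; ring.
have abE : qform A (fun i => 1 * a i + (- n) * b i) =
    qform A a + n ^+ 2 * qform A b - n * polar A a b.
  by rewrite qform_lin; ring.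
have lam : qform A (fun i => 1 * a i + (- n) * b i) + (x * y - n ^+ 2) * qform A b + z * H = 1.
  transitivity ((n + t) / t - n * t^-1); last by field; lra.
  by rewrite -e1 -e2 abE /H; ring.
have z0 : 0 < z by lra.
have D0 : 0 < x * y - n ^+ 2 by lra.
have Qab0 := qform_ge0 (fun i => 1 * a i + (- n) * b i) pA.
have DQb0 : 0 <= (x * y - n ^+ 2) * qform A b by rewrite mulr_ge0 ?qform_ge0 // ltW.
have DQe0 : 0 <= (x * y - n ^+ 2) * qform A e by rewrite mulr_ge0 ?qform_ge0 // ltW.
have Qce0 := qform_ge0 (fun i => x * c i + (- n) * e i) pA.
have H0 : H = 0.
  have : 0 <= x * H by rewrite HE addr_ge0.
  rewrite pmulr_rge0 // le0r => /orP[/eqP //|Hp].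
  (* A positive [H] would give [z * H > k * H >= 1], too large for [lam]. *)
  have kH : 1 <= k * H by apply: rat_int_gt0_ge1 => //; rewrite mulr_gt0.
  have : k * H < z * H by rewrite ltr_pM2r.
  lra.
have e0 : forall i, e i = 0.
  apply: (qform_eq0 pA); apply/eqP; have := HE; rewrite H0 mulr0 => /esym/eqP.
  by rewrite paddr_eq0 // mulf_eq0 => /andP[_ /orP[/eqP|//]]; lra.
have c0 : forall i, c i = 0.
  move=> i; have : qform A (fun i => x * c i + (- n) * e i) = 0.
    by apply/eqP; have := HE; rewrite H0 mulr0 => /esym/eqP; rewrite paddr_eq0 // => /andP[].
  move=> /(qform_eq0 pA)/(_ i); rewrite e0 mulr0 addr0 => /eqP.
  by rewrite mulf_eq0 => /orP[/eqP|/eqP //]; lra.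
have {}abint := abint c0 e0.
have ce0 : polar A c e = 0.
  by apply: big1 => i _; apply: big1 => j _; rewrite !c0; ring.
move: lam e2; rewrite H0 ce0 !mulr0 !addr0 => lam e2.
(* The middle term of [lam] becomes a positive integer times the value of the form at the integral
   vector [t b]; the summand [0 * b i] only gives the shape of [qform_lin]. *)
have tbE : (x * y - n ^+ 2) * qform A b =
   (x * y - n ^+ 2) / t ^+ 2 * qform A (fun i => t * b i + 0 * b i).
  by rewrite qform_lin; field; lra.
have tbi : qform A (fun i => t * b i + 0 * b i) \is a Num.int.
  by apply: qform_int => i; rewrite mul0r addr0; case: (abint i).
have abi : qform A (fun i => 1 * a i + - n * b i) \is a Num.int.
  by apply: qform_int => i; rewrite mul1r mulNr; case: (abint i).
have Dt0 : 0 < (x * y - n ^+ 2) / t ^+ 2 by rewrite divr_gt0 ?exprn_gt0.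
have Dt1 := rat_int_gt0_ge1 dint Dt0.
have Qtb0 := qform_ge0 (fun i => t * b i + 0 * b i) pA.
(* If [Q(a - n b)] is positive it exhausts the sum 1, so [b = 0], and the coefficient [t^-1] of
   [sqrt (x y)] would be 0. *)
move: (Qab0); rewrite le0r => /orP[/eqP ab0|abp]; last first.
  have := rat_int_gt0_ge1 abi abp => ab1.
  have b0 : forall i, b i = 0.
    by apply: (qform_eq0 pA); apply/eqP; rewrite -(mulrI_eq0 _ (lregP (lt0r_neq0 D0))); lra.
  suff p0 : polar A a b = 0 by have := invr_gt0 t; rewrite -e2 p0 t0 ltxx.
  by apply: big1 => i _; apply: big1 => j _; rewrite !b0; ring.
(* Now [a = n b], so [P(a, b) = 2 n Q(b)]. Both integer factors of the remaining term are 1, and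
   [2 n / t^2 = 1 / t] leads to the case excluded by [dne]. *)
have aE i : a i = n * b i + 0 * b i.
  by have := qform_eq0 pA ab0 i; lra.
rewrite (eq_polar _ _ aE) polar_lin polarxx mul0r addr0 in e2.
have Qtb1 : qform A (fun i => t * b i + 0 * b i) = 1.
  have Qtbp : 0 < qform A (fun i => t * b i + 0 * b i).
    rewrite lt0r Qtb0 andbT; apply/eqP => q0.
    by move: lam; rewrite ab0 tbE q0 mulr0 addr0; lra.
  have := rat_int_gt0_ge1 tbi Qtbp.
  move: lam; rewrite ab0 tbE add0r => lam Q1; nra.
have Dt : (x * y - n ^+ 2) = t ^+ 2.
  move: lam; rewrite ab0 tbE Qtb1 mulr1 add0r => /(congr1 ( *%R^~ (t ^+ 2))).
  by rewrite divfK ?mul1r // expf_neq0 ?lt0r_neq0.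
have Qb : qform A b = (t ^+ 2)^-1.
  have : t ^+ 2 * qform A b = 1 by rewrite -Qtb1 qform_lin; ring.
  by move=> h; rewrite -[RHS]mulr1 -h mulKf // expf_neq0 ?lt0r_neq0.
apply: dne; split; last lra.
have -> : t = t ^+ 2 * t^-1 by field; lra.
by rewrite -e2 Qb; field; lra.
Qed.

(** * Square roots of squarefree integers *)

(** In lowest terms, the square of the denominator divides the squared numerator times [m], hence
    divides [m] by coprimality. *)
Lemma squarefree_rat_int (m : nat) (c : rat) :
  squarefreen m -> c ^+ 2 * m%:R \is a Num.int -> c \is a Num.int.
Proof.
move=> sqf /intrP[k ek].
suff : (`|denq c| * `|denq c| %| m)%N.
  move/sqf => d1; rewrite Qint_def; have := denq_gt0 c; lia.
have : numq c ^+ 2 * m%:Z = k * denq c ^+ 2.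
  apply: (@intr_inj rat); rewrite !rmorphM /= -ek.
  rewrite -{3}(divq_num_den c); have : (denq c)%:~R != 0 :> rat by rewrite intr_eq0 denq_neq0.
  by move=> h; rewrite -pmulrn; field.
move=> /(congr1 absz); rewrite !abszM !mulnn /= => e.
have : (`|denq c| ^ 2 %| `|numq c| ^ 2 * m)%N by rewrite e dvdn_mull.
by rewrite Gauss_dvdr // coprimeXl // coprimeXr // coprime_sym coprime_num_den.
Qed.

Lemma squarefree_nonsquare (m : nat) (c : rat) :
  (1 < m)%N -> squarefreen m -> c ^+ 2 != m%:R.
Proof.
move=> m1 sqf; apply/eqP => e.
have /intrP[k ck] : c \is a Num.int.
  by apply: (@squarefree_rat_int 1) => [d|]; rewrite ?dvdn1 ?muln_eq1 ?e ?rpredM ?rpred_nat // => /andP[/eqP].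
have : `|k|%N = 1%N.
  apply: sqf; move: e; rewrite ck -rmorphXn -[m%:R]/(m%:Z%:~R) => /intr_inj/(congr1 absz).
  by rewrite abszX /= -mulnn => ->.
move=> k1; move: e; rewrite ck -rmorphXn -[m%:R]/(m%:Z%:~R) => /intr_inj; lia.
Qed.

Lemma nonsquare_indep1 (d u v : rat) (s : algC) :
  (forall w : rat, w ^+ 2 != d) -> s ^+ 2 = ratr d -> ratr u + ratr v * s = 0 ->
  u = 0 /\ v = 0.
Proof.
move=> nsq es e; have [v0|v0] := eqVneq v 0.
  by split=> //; move: e; rewrite v0 rmorph0 mul0r addr0 => /eqP; rewrite fmorph_eq0 => /eqP.
case/negP: (nsq (- u / v)); apply/eqP; apply: (fmorph_inj (@ratr algC)).
rewrite /= -es rmorphXn fmorph_div rmorphN /=; congr (_ ^+ 2).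
have v0' : ratr v != 0 :> algC by rewrite fmorph_eq0.
by apply: (mulIf v0'); rewrite divfK //; move/eqP: e; rewrite addr_eq0 => /eqP ->; ring.
Qed.

(** Multiplying the relation by its conjugate under [w |-> - w] gives two rational equations, and
    eliminating between them gives [a^2 - d b^2 = m (c^2 - d f^2)] up to sign. For either sign,
    squares become equal to [m] or [d m] times other squares, so they vanish. *)
Lemma nonsquare_indep2 (d m a b c f : rat) (s w : algC) :
  (forall u : rat, u ^+ 2 != d) -> (forall u : rat, u ^+ 2 != m) ->
  (forall u : rat, u ^+ 2 != d * m) -> s ^+ 2 = ratr d -> w ^+ 2 = ratr m ->
  ratr a + ratr b * s + (ratr c + ratr f * s) * w = 0 ->
  [/\ a = 0, b = 0, c = 0 & f = 0].
Proof.
move=> nd nm ndm es ew e.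
have quot0 (M u v : rat) : (forall t : rat, t ^+ 2 != M) -> u ^+ 2 = M * v ^+ 2 -> u = 0 /\ v = 0.
  move=> nM h; have [v0|v0] := eqVneq v 0.
    by split=> //; move: h => /eqP; rewrite v0 expr0n mulr0 sqrf_eq0 => /eqP.
  by case/negP: (nM (u / v)); rewrite expr_div_n h mulfK // sqrf_eq0.
have [h1 h2] : a ^+ 2 + b ^+ 2 * d - m * (c ^+ 2 + f ^+ 2 * d) = 0 /\
   a * b - m * c * f + (a * b - m * c * f) = 0.
  apply: (nonsquare_indep1 nd es); rewrite !(rmorphB, rmorphD, rmorphM, rmorphXn) /= -es -ew.
  transitivity ((ratr a + ratr b * s + (ratr c + ratr f * s) * w) *
    (ratr a + ratr b * s - (ratr c + ratr f * s) * w)); first by ring.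
  by rewrite e mul0r.
have : (a ^+ 2 - d * b ^+ 2) ^+ 2 = (m * (c ^+ 2 - d * f ^+ 2)) ^+ 2.
  have h2' : a * b = m * c * f by lra.
  have h1' : a ^+ 2 + b ^+ 2 * d = m * (c ^+ 2 + f ^+ 2 * d) by lra.
  transitivity ((a ^+ 2 + b ^+ 2 * d) ^+ 2 - 4 * d * (a * b) ^+ 2); first by ring.
  by rewrite h1' h2'; ring.
move=> /eqP; rewrite eqf_sqr => /orP[] /eqP h3.
  have [-> ->] : a = 0 /\ c = 0 by apply: (quot0 m) => //; lra.
  have d0 : d != 0 by apply: contraTN (nd 0) => /eqP ->; rewrite expr0n eqxx.
  have [-> ->] : b = 0 /\ f = 0.
    apply: (quot0 m) => //; apply: (mulfI d0); lra.
  by split.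
have [-> ->] : a = 0 /\ f = 0 by apply: (quot0 (d * m)) => //; lra.
have [cd0 b0] : d * b = 0 /\ c = 0.
  apply: (quot0 (d * m)) => //.
  have -> : (d * b) ^+ 2 = d * (b ^+ 2 * d) by ring.
  by rewrite -mulrA; congr (d * _); lra.
have d0 : d != 0 by apply: contraTN (nd 0) => /eqP ->; rewrite expr0n eqxx.
by split=> //; apply: (mulfI d0); rewrite cd0 mulr0.
Qed.

(** * Biquadratic elements and their conjugates *)

(* With [sx], [sy], [sz] square roots of [x], [y], [z], changing their signs gives the
   conjugates in the biquadratic field. *)
Definition tri (sx sy sz : algC) (a b c e : rat) : algC :=
  ratr a + ratr b * (sx * sy) + ratr c * (sx * sz) + ratr e * (sy * sz).

(** The products are the radicands of the three quadratic subfields; their squarefreeness forces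
    [x], [y], [z] to be pairwise coprime. *)
Definition admissible (x y z : nat) : Prop :=
  [/\ (1 < x * y)%N, (1 < x * z)%N & (1 < y * z)%N] /\
  [/\ squarefreen (x * y), squarefreen (x * z) & squarefreen (y * z)].

Lemma triM (x y z : nat) (sx sy sz : algC) (a b c e a' b' c' e' : rat) :
  sx ^+ 2 = x%:R -> sy ^+ 2 = y%:R -> sz ^+ 2 = z%:R ->
  tri sx sy sz a b c e * tri sx sy sz a' b' c' e' =
  tri sx sy sz
    (a * a' + x%:R * y%:R * (b * b') + x%:R * z%:R * (c * c') + y%:R * z%:R * (e * e'))
    (a * b' + b * a' + z%:R * (c * e' + e * c'))
    (a * c' + c * a' + y%:R * (b * e' + e * b'))
    (a * e' + e * a' + x%:R * (b * c' + c * b')).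
Proof.
move=> ex ey ez; rewrite /tri !(rmorphD, rmorphM) /= !ratr_nat -ex -ey -ez; ring.
Qed.

Lemma triD (sx sy sz : algC) (a b c e a' b' c' e' : rat) :
  tri sx sy sz a b c e + tri sx sy sz a' b' c' e' =
  tri sx sy sz (a + a') (b + b') (c + c') (e + e').
Proof. rewrite /tri !rmorphD /=; ring. Qed.

(** The coordinates of the value of [P] are chosen before the square roots, so one tuple serves all
    conjugates at once. This replaces the action of the Galois group. *)
Lemma tri_horner (x y z : nat) (a b c e : rat) (P : {poly int}) :
  exists A B C E : rat, forall sx sy sz : algC,
    sx ^+ 2 = x%:R -> sy ^+ 2 = y%:R -> sz ^+ 2 = z%:R ->
    (map_poly intr P).[tri sx sy sz a b c e] = tri sx sy sz A B C E.
Proof.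
elim/poly_ind: P => [|P k [A [B [C [E IH]]]]].
  by exists 0, 0, 0, 0 => sx sy sz _ _ _; rewrite rmorph0 horner0 /tri rmorph0 !mul0r !addr0.
do 4!eexists; move=> sx sy sz ex ey ez.
rewrite rmorphD rmorphM /= map_polyX map_polyC hornerMXaddC IH //.
rewrite (triM _ _ _ _ _ _ _ _ ex ey ez).
have kE : k%:~R = tri sx sy sz k%:~R 0 0 0 :> algC.
  by rewrite /tri ratr_int !rmorph0 !mul0r !addr0.
rewrite -[X in _ + X]/(k%:~R) kE; exact: triD.
Qed.

Lemma tri_inj (x y z : nat) (sx sy sz : algC) (a b c e a' b' c' e' : rat) :
  admissible x y z ->
  sx ^+ 2 = x%:R -> sy ^+ 2 = y%:R -> sz ^+ 2 = z%:R ->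
  tri sx sy sz a b c e = tri sx sy sz a' b' c' e' ->
  [/\ a = a', b = b', c = c' & e = e'].
Proof.
move=> [[xy xz yz] [sxy sxz syz]] ex ey ez /eqP; rewrite -subr_eq0 => /eqP h.
have x0 : x%:R != 0 :> algC by rewrite pnatr_eq0; lia.
have x0q : x%:R != 0 :> rat by rewrite pnatr_eq0; lia.
have s0 : sx != 0 by rewrite -sqrf_eq0 ex.
(* Since [sy * sz] is the product of [sx * sy] and [sx * sz] divided by [x], the last coordinate
   enters [nonsquare_indep2] divided by [x]. *)
suff : [/\ a - a' = 0, b - b' = 0, c - c' = 0 & (e - e') / x%:R = 0].
  move=> [h1 h2 h3 /eqP]; rewrite mulf_eq0 invr_eq0 (negPf x0q) orbF => /eqP h4.
  by split; lra.
apply: (@nonsquare_indep2 (x * y)%:R (x * z)%:R _ _ _ _ (sx * sy) (sx * sz)).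
- by move=> u; apply: squarefree_nonsquare.
- by move=> u; apply: squarefree_nonsquare.
- move=> u; have /negP := @squarefree_nonsquare (y * z) (u / x%:R) yz syz.
  move=> h'; apply/negP => /eqP hu; apply: h'.
  by rewrite expr_div_n hu; apply/eqP; rewrite !natrM; field.
- by rewrite exprMn ex ey ratr_nat natrM.
- by rewrite exprMn ex ez ratr_nat natrM.
rewrite -[RHS]h /tri !(rmorphD, rmorphN) /= fmorph_div rmorphB /= ratr_nat -ex.
by field.
Qed.

(** The minimal polynomial vanishes at the first element, so by [tri_inj] the four coordinates of
    its value are 0; the same coordinates give its value at the conjugate. *)
Lemma tri_conj_Aint (x y z : nat) (sx sy sz sx' sy' sz' : algC) (a b c e : rat) :
  admissible x y z ->
  sx ^+ 2 = x%:R -> sy ^+ 2 = y%:R -> sz ^+ 2 = z%:R ->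
  sx' ^+ 2 = x%:R -> sy' ^+ 2 = y%:R -> sz' ^+ 2 = z%:R ->
  tri sx sy sz a b c e \in Aint -> tri sx' sy' sz' a b c e \in Aint.
Proof.
move=> adm ex ey ez ex' ey' ez' vA.
have /floorpP[P eP] := vA.
have [A [B [C [E hP]]]] := tri_horner x y z a b c e P.
have : tri sx sy sz A B C E = tri sx sy sz 0 0 0 0.
  rewrite -hP // -eP; have /rootP -> := root_minCpoly (tri sx sy sz a b c e).
  by rewrite /tri rmorph0 !mul0r !addr0.
move=> /(tri_inj adm ex ey ez)[A0 B0 C0 E0].
apply: (@root_monic_Aint (map_poly intr P)).
- by apply/rootP; rewrite hP // A0 B0 C0 E0 /tri rmorph0 !mul0r !addr0.
- by rewrite -eP minCpoly_monic.
by rewrite -eP.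
Qed.

(** * Integrality conditions *)

Lemma ratr_Aint_int (a : rat) : ratr a \in Aint -> a \is a Num.int.
Proof.
move=> h; have /intrP[m em] := Cint_rat_Aint (Crat_rat a) h.
apply/intrP; exists m; apply: (fmorph_inj (@ratr algC)).
by rewrite /= em ratr_int.
Qed.

(* From the integrality of the trace [2 f] and the norm [f^2 - d g^2]. *)
Lemma quadratic_integer (d : nat) (f g : rat) (s : algC) :
  squarefreen d -> s ^+ 2 = d%:R ->
  ratr f + ratr g * s \in Aint -> ratr f - ratr g * s \in Aint ->
  exists F G k : int, [/\ 2 * f = F%:~R, 2 * g = G%:~R & F ^+ 2 - d%:Z * G ^+ 2 = 4 * k].
Proof.
move=> sqf es h1 h2.
have /intrP[F eF] : 2 * f \is a Num.int.
  apply: ratr_Aint_int; have := rpredD h1 h2; congr (_ \in Aint).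
  by rewrite rmorphM rmorph_nat; ring.
(* The difference of the conjugates is [2 g s], whose square is [(2 g)^2 d]; squarefreeness of [d]
   then makes [2 g] integral. *)
have /intrP[G eG] : 2 * g \is a Num.int.
  apply: (squarefree_rat_int sqf); apply: ratr_Aint_int.
  have h := rpredB h1 h2; have := rpredM h h; congr (_ \in Aint).
  by rewrite !rmorphM !rmorph_nat -es /=; ring.
have /intrP[k ek] : f ^+ 2 - d%:R * g ^+ 2 \is a Num.int.
  apply: ratr_Aint_int; have := rpredM h1 h2; congr (_ \in Aint).
  by rewrite rmorphB !rmorphM /= !ratr_nat -es; ring.
exists F, G, k; split=> //; apply: (@intr_inj rat).
rewrite rmorphB !rmorphM /= -ek -eF -eG; rewrite -pmulrn; ring.
Qed.

(* The conditions that the relative trace [2 a + 2 b sqrt (x y)] and norm over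
   Q(sqrt (x y)) are integral. *)
Lemma tri_Aint_coords (x y z : nat) (sx sy sz : algC) (a b c e : rat) :
  admissible x y z ->
  sx ^+ 2 = x%:R -> sy ^+ 2 = y%:R -> sz ^+ 2 = z%:R ->
  tri sx sy sz a b c e \in Aint ->
  exists A B C E F G k l : int,
    [/\ 4 * a = A%:~R, 4 * b = B%:~R, 4 * c = C%:~R & 4 * e = E%:~R] /\
    [/\ A ^+ 2 - (x * y)%:Z * B ^+ 2 = 4 * k,
        A ^+ 2 + (x * y)%:Z * B ^+ 2 - z%:Z * (x%:Z * C ^+ 2 + y%:Z * E ^+ 2) = 8 * F,
        A * B - z%:Z * (C * E) = 4 * G &
        F ^+ 2 - (x * y)%:Z * G ^+ 2 = 4 * l].
Proof.
move=> adm ex ey ez v1.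
(* Negating [sz] fixes [sx * sy], while negating [sx] or [sy] changes its sign. Hence [v1, v2] and
   [v3, v4] are paired over Q(sqrt (x y)); the other pairings serve the other two subfields. *)
have v2 : tri sx sy (- sz) a b c e \in Aint.
  by apply: (tri_conj_Aint adm ex ey ez) v1; rewrite ?sqrrN.
have v3 : tri (- sx) sy sz a b c e \in Aint.
  by apply: (tri_conj_Aint adm ex ey ez) v1; rewrite ?sqrrN.
have v4 : tri sx (- sy) sz a b c e \in Aint.
  by apply: (tri_conj_Aint adm ex ey ez) v1; rewrite ?sqrrN.
have [_ [sxy sxz syz]] := adm.
have exy : (sx * sy) ^+ 2 = (x * y)%:R by rewrite exprMn ex ey natrM.
have exz : (sx * sz) ^+ 2 = (x * z)%:R by rewrite exprMn ex ez natrM.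
have eyz : (sy * sz) ^+ 2 = (y * z)%:R by rewrite exprMn ey ez natrM.
have [] := @quadratic_integer (x * y) (2 * a) (2 * b) (sx * sy) sxy exy.
- by have := rpredD v1 v2; congr (_ \in Aint); rewrite /tri !rmorphM rmorph_nat /=; ring.
- by have := rpredD v3 v4; congr (_ \in Aint); rewrite /tri !rmorphM rmorph_nat /=; ring.
move=> A [B [k [eA eB h1]]].
have [] := @quadratic_integer (x * z) (2 * a) (2 * c) (sx * sz) sxz exz.
- by have := rpredD v1 v4; congr (_ \in Aint); rewrite /tri !rmorphM rmorph_nat /=; ring.
- by have := rpredD v2 v3; congr (_ \in Aint); rewrite /tri !rmorphM rmorph_nat /=; ring.
move=> _ [C [_ [_ eC _]]].
have [] := @quadratic_integer (y * z) (2 * a) (2 * e) (sy * sz) syz eyz.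
- by have := rpredD v1 v3; congr (_ \in Aint); rewrite /tri !rmorphM rmorph_nat /=; ring.
- by have := rpredD v2 v4; congr (_ \in Aint); rewrite /tri !rmorphM rmorph_nat /=; ring.
move=> _ [E [_ [_ eE _]]].
(* The product of the first two conjugates is [f + g sqrt (x y)], that of the other two is
   [f - g sqrt (x y)]. *)
pose f := a ^+ 2 + x%:R * y%:R * b ^+ 2 - z%:R * (x%:R * c ^+ 2 + y%:R * e ^+ 2).
pose g := a * b - z%:R * (c * e) + (a * b - z%:R * (c * e)).
have [] := @quadratic_integer (x * y) f g (sx * sy) sxy exy.
- have := rpredM v1 v2; congr (_ \in Aint).
  by rewrite /tri /f /g !(rmorphD, rmorphN, rmorphM) /= !ratr_nat -ex -ey -ez; ring.
- have := rpredM v3 v4; congr (_ \in Aint).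
  by rewrite /tri /f /g !(rmorphD, rmorphN, rmorphM) /= !ratr_nat -ex -ey -ez; ring.
move=> F [G [l [eF eG h2]]].
exists A, B, C, E, F, G, k, l; split; first by rewrite -eA -eB -eC -eE; split; ring.
split=> //; apply: (@intr_inj rat).
- rewrite rmorphB rmorphD !rmorphM rmorphD !rmorphM /= -eA -eB -eC -eE -eF /f.
  by rewrite -!pmulrn; ring.
- by rewrite rmorphB !rmorphM /= -eA -eB -eC -eE -eG /g -!pmulrn; ring.
Qed.

(** * Congruences modulo 4 and their consequences for the coordinates *)

Lemma mod4_eq0 (k : int) : k%:~R = 0 :> 'Z_4 -> exists m : int, k = 4 * m.
Proof.
have natP (n : nat) : n%:R = 0 :> 'Z_4 -> (4 %| n)%N.
  by move=> /(congr1 val); rewrite /= val_Zp_nat // => /eqP.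
case: k => n.
  by move=> /natP/dvdnP[m ->]; exists m; lia.
rewrite NegzE mulrNz => /eqP; rewrite oppr_eq0 => /eqP/natP/dvdnP[m ->].
by exists (- m%:Z); lia.
Qed.

Lemma mod4_even (k : int) : 2 * k%:~R = 0 :> 'Z_4 -> exists m : int, k = 2 * m.
Proof.
move=> h; have [|m em] := @mod4_eq0 (2 * k); first by rewrite rmorphM.
exists m; lia.
Qed.

(** Splits an element of ['Z_4] into its four residues. The [suff] steps below make the statements
    boolean, so that each case is closed by evaluation. *)
Ltac case_Z4 := case=> [[|[|[|[|//]]]]] ?.

Lemma mod4_norm (d u w : 'Z_4) : d != 0 -> d != 1 -> u ^+ 2 - d * w ^+ 2 = 0 ->
  2 * u = 0 /\ 2 * w = 0.
Proof.
suff : [&& d != 0, d != 1 & u ^+ 2 - d * w ^+ 2 == 0] ==> (2 * u == 0) && (2 * w == 0).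
  by move=> h d0 d1 /eqP e; move: h; rewrite d0 d1 e => /andP[/eqP ? /eqP ?].
by move: d u w; do 3 case_Z4.
Qed.

(** For [d = 3] the odd pair [u = w = 1] solves the first equation; the second one excludes it. *)
Lemma mod4_norm_zero (d u w : 'Z_4) : d != 0 -> d != 1 -> u ^+ 2 + d * w ^+ 2 = 0 ->
  2 * (u * w) = 0 -> 2 * u = 0 /\ 2 * w = 0.
Proof.
suff : [&& d != 0, d != 1, u ^+ 2 + d * w ^+ 2 == 0 & 2 * (u * w) == 0] ==>
   (2 * u == 0) && (2 * w == 0).
  by move=> h d0 d1 /eqP e /eqP e'; move: h; rewrite d0 d1 e e' => /andP[/eqP ? /eqP ?].
by move: d u w; do 3 case_Z4.
Qed.

Lemma mod4_relative (x y z C E : 'Z_4) : x * y != 0 -> x * y != 1 -> x * z != 0 -> y * z != 0 ->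
  z * (C * E) = 0 -> z * (x * C ^+ 2 + y * E ^+ 2) = 0 -> 2 * C = 0 /\ 2 * E = 0.
Proof.
suff : [&& x * y != 0, x * y != 1, x * z != 0 & y * z != 0] ==>
   ((z * (C * E) == 0) && (z * (x * C ^+ 2 + y * E ^+ 2) == 0) ==>
   (2 * C == 0) && (2 * E == 0)).
  move=> h h1 h2 h3 h4 /eqP h5 /eqP h6.
  by move: h; rewrite h1 h2 h3 h4 h5 h6 => /andP[/eqP ? /eqP ?].
(* Triples that violate the hypotheses disappear before [C] and [E] are split, which keeps the
   enumeration small. *)
by move: x y z; do 3 case_Z4 => //; move: C E; do 2 case_Z4.
Qed.

Lemma mod4_relative1 (x y z A B C E : 'Z_4) : x * y = 1 -> x * z != 0 ->
  A ^+ 2 = B ^+ 2 -> A ^+ 2 + B ^+ 2 = z * (x * C ^+ 2 + y * E ^+ 2) ->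
  A * B = z * (C * E) -> 2 * (C - E) = 0.
Proof.
suff : (x * y == 1) && (x * z != 0) ==> ((A ^+ 2 == B ^+ 2) ==>
   ((A ^+ 2 + B ^+ 2 == z * (x * C ^+ 2 + y * E ^+ 2)) && (A * B == z * (C * E)) ==>
   (2 * (C - E) == 0))).
  move=> h /eqP h1 h2 /eqP h3 /eqP h4 /eqP h5.
  by move: h; rewrite h1 h2 h3 h4 h5 => /eqP.
by move: x y z; do 3 case_Z4 => //; move: A B; do 2 case_Z4 => //; move: C E; do 2 case_Z4.
Qed.

(** These are the equations of [tri_Aint_halves] for the triple [(1, 2, 3)] modulo 4, where -3 and
    -6 become 1 and 2. *)
Lemma mod4_special (A B C E : 'Z_4) : A ^+ 2 + 2 * B ^+ 2 + C ^+ 2 + 2 * E ^+ 2 = 0 ->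
  2 * (A * B - 3 * (C * E)) = 0 -> 2 * C = 0.
Proof.
suff : (A ^+ 2 + 2 * B ^+ 2 + C ^+ 2 + 2 * E ^+ 2 == 0) &&
  (2 * (A * B - 3 * (C * E)) == 0) ==> (2 * C == 0).
  by move=> h /eqP h1 /eqP h2; move: h; rewrite h1 h2 => /eqP.
by move: A B C E; do 4 case_Z4.
Qed.

Lemma mod4_mul4 (k : int) : (4 * k)%:~R = 0 :> 'Z_4.
Proof.
have -> : (4 * k)%:~R = 4%:R * k%:~R :> 'Z_4 by rewrite rmorphM.
by rewrite (_ : 4%:R = 0) ?mul0r //; apply: val_inj.
Qed.

Lemma squarefree_mod4 (m : nat) : squarefreen m -> m%:R != 0 :> 'Z_4.
Proof.
move=> sqf; apply/eqP => h; have [|k ek] := @mod4_eq0 m%:Z; first by rewrite -pmulrn.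
suff /sqf : (2 * 2 %| m)%N by [].
by apply/dvdnP; exists `|k|%N; lia.
Qed.

(** As [x y] is 2 or 3 modulo 4, [mod4_norm] makes the integers [A, B] of the trace and [F, G] of
    the norm even; the remaining equations then make [C, E] even by [mod4_relative]. *)
Lemma tri_Aint_halves (x y z : nat) (sx sy sz : algC) (a b c e : rat) :
  admissible x y z -> x%:R * y%:R != 1 :> 'Z_4 ->
  sx ^+ 2 = x%:R -> sy ^+ 2 = y%:R -> sz ^+ 2 = z%:R ->
  tri sx sy sz a b c e \in Aint ->
  exists A B C E F G : int,
    [/\ 2 * a = A%:~R, 2 * b = B%:~R, 2 * c = C%:~R & 2 * e = E%:~R] /\
    A ^+ 2 + (x * y)%:Z * B ^+ 2 - z%:Z * (x%:Z * C ^+ 2 + y%:Z * E ^+ 2) = 4 * F /\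
    A * B - z%:Z * (C * E) = 2 * G.
Proof.
move=> adm d1 ex ey ez /(tri_Aint_coords adm ex ey ez).
move=> [A [B [C [E [F [G [k [l [[eA eB eC eE] [e1 e2 e3 e4]]]]]]]]]].
have [_ [/squarefree_mod4 dxy /squarefree_mod4 dxz /squarefree_mod4 dyz]] := adm.
rewrite !natrM in dxy dxz dyz.
have cst (m : int) (m' : nat) : (m'%:Z * m)%:~R = m'%:R * m%:~R :> 'Z_4 by rewrite intrM -pmulrn.
have sqr (m : int) : (m ^+ 2)%:~R = m%:~R ^+ 2 :> 'Z_4 by rewrite rmorphXn.
have cstM (m : int) : ((x * y)%:Z * m)%:~R = x%:R * y%:R * m%:~R :> 'Z_4 by rewrite cst natrM.
have [/mod4_even[A' hA] /mod4_even[B' hB]] : 2 * A%:~R = 0 :> 'Z_4 /\ 2 * B%:~R = 0 :> 'Z_4.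
  apply: (mod4_norm dxy d1).
  by rewrite -!sqr -cstM -rmorphB e1; exact: mod4_mul4.
have [/mod4_even[F' hF] /mod4_even[G' hG]] : 2 * F%:~R = 0 :> 'Z_4 /\ 2 * G%:~R = 0 :> 'Z_4.
  apply: (mod4_norm dxy d1).
  by rewrite -!sqr -cstM -rmorphB e4; exact: mod4_mul4.
have [/mod4_even[C' hC] /mod4_even[E' hE]] : 2 * C%:~R = 0 :> 'Z_4 /\ 2 * E%:~R = 0 :> 'Z_4.
  apply: (mod4_relative dxy d1 dxz dyz).
    rewrite -rmorphM -cst.
    have -> : z%:Z * (C * E) = 4 * (A' * B' - G) by rewrite hA hB in e3; lra.
    exact: mod4_mul4.
  rewrite -!sqr -!cst -rmorphD -cst.
  have -> : z%:Z * (x%:Z * C ^+ 2 + y%:Z * E ^+ 2) =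
     4 * (A' ^+ 2 + (x * y)%:Z * B' ^+ 2 - 2 * F) by rewrite hA hB in e2; lra.
  exact: mod4_mul4.
exists A', B', C', E', F', G'; split; last first.
  by rewrite hA hB hC hE hF in e2; rewrite hA hB hC hE hG in e3; split; lra.
by move: eA eB eC eE; rewrite hA hB hC hE !rmorphM /=; split; lra.
Qed.

(** If [c = e = 0], the element lies in Q(sqrt (x y)), whose ring of integers is here
    Z[sqrt (x y)]. *)
Lemma tri_Aint_not1mod4 (x y z : nat) (sx sy sz : algC) (a b c e : rat) :
  admissible x y z -> x%:R * y%:R != 1 :> 'Z_4 ->
  sx ^+ 2 = x%:R -> sy ^+ 2 = y%:R -> sz ^+ 2 = z%:R ->
  tri sx sy sz a b c e \in Aint ->
  [/\ 2 * c \is a Num.int, 2 * e \is a Num.int &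
    c = 0 -> e = 0 -> a \is a Num.int /\ b \is a Num.int].
Proof.
move=> adm d1 ex ey ez /(tri_Aint_halves adm d1 ex ey ez).
move=> [A [B [C [E [F [G [[eA eB eC eE] [e1 e2]]]]]]]].
have [_ [/squarefree_mod4 dxy _ _]] := adm.
rewrite natrM in dxy.
split; [by rewrite eC rpred_int | by rewrite eE rpred_int | move=> c0 e0].
have C0 : C = 0 by apply: (@intr_inj rat); rewrite -eC c0 mulr0.
have E0 : E = 0 by apply: (@intr_inj rat); rewrite -eE e0 mulr0.
rewrite C0 E0 in e1; rewrite C0 in e2.
have [/mod4_even[a' ha] /mod4_even[b' hb]] : 2 * A%:~R = 0 :> 'Z_4 /\ 2 * B%:~R = 0 :> 'Z_4.
  apply: (mod4_norm_zero dxy d1).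
    rewrite -natrM -(mod4_mul4 F) (_ : 4 * F = A ^+ 2 + (x * y)%:Z * B ^+ 2); last by lra.
    by rewrite intrD intrM rmorphXn -pmulrn rmorphXn.
  rewrite -(mod4_mul4 G) (_ : 4 * G = 2%:Z * (A * B)); last by lra.
  by rewrite !intrM.
split; apply/intrP.
- by exists a'; move: eA; rewrite ha rmorphM /=; lra.
- by exists b'; move: eB; rewrite hb rmorphM /=; lra.
Qed.

Lemma int_parity (a : int) : exists m : int, a = 2 * m \/ a = 2 * m + 1.
Proof. by exists (a %/ 2)%Z; lia. Qed.

(** The first equation excludes opposite parities of [A] and [B], the third excludes two odd
    numbers, and the second makes the halves agree modulo 2, where [2 n + 1] acts as 1. *)
Lemma quadratic_parity (A B n d k F G : int) :
  A ^+ 2 - (1 + 4 * d) * B ^+ 2 = 4 * k -> A ^+ 2 + (1 + 4 * d) * B ^+ 2 = 8 * F ->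
  A * B = 4 * G ->
  exists A' B' m : int, [/\ A = 2 * A', B = 2 * B' & A' - (2 * n + 1) * B' = 2 * m].
Proof.
have [A' [->|->]] := int_parity A; have [B' [->|->]] := int_parity B => e1 e2 e3.
- have [A1 [hA1|hA1]] := int_parity A'; have [B1 [hB1|hB1]] := int_parity B'; subst A' B'.
  + by exists (2 * A1), (2 * B1), (A1 - (2 * n + 1) * B1); split; ring.
  + by exfalso; clear e1 e3; lia.
  + by exfalso; clear e1 e3; lia.
  by exists (2 * A1 + 1), (2 * B1 + 1), (A1 - (2 * n + 1) * B1 - n); split; ring.
- by exfalso; clear e2 e3; lia.
- by exfalso; clear e2 e3; lia.
by exfalso; clear e1 e2; lia.
Qed.

(** Now [c] and [e] may have denominator 4, but their difference has denominator at most 2, which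
    still makes [4 H] integral. If [c = e = 0], then [2 a] and [2 b] are integers of equal parity,
    and [n] is odd. *)
Lemma tri_Aint_1mod4 (x y z : nat) (sx sy sz : algC) (a b c e : rat) (n : nat) :
  admissible x y z -> x%:R * y%:R = 1 :> 'Z_4 -> odd n ->
  sx ^+ 2 = x%:R -> sy ^+ 2 = y%:R -> sz ^+ 2 = z%:R ->
  tri sx sy sz a b c e \in Aint ->
  [/\ 4 * e \is a Num.int, 2 * (c - e) \is a Num.int &
    c = 0 -> e = 0 -> 2 * b \is a Num.int /\ a - n%:R * b \is a Num.int].
Proof.
move=> adm d1 oddn ex ey ez /(tri_Aint_coords adm ex ey ez).
move=> [A [B [C [E [F [G [k [l [[eA eB eC eE] [e1 e2 e3 e4]]]]]]]]]].
have [_ [_ /squarefree_mod4 dxz _]] := adm.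
rewrite !natrM in dxz.
have cst (m : int) (m' : nat) : (m'%:Z * m)%:~R = m'%:R * m%:~R :> 'Z_4 by rewrite intrM -pmulrn.
have sqr (m : int) : (m ^+ 2)%:~R = m%:~R ^+ 2 :> 'Z_4 by rewrite rmorphXn.
have cstM (m : int) : ((x * y)%:Z * m)%:~R = m%:~R :> 'Z_4 by rewrite cst natrM d1 mul1r.
have AB2 : A%:~R ^+ 2 = B%:~R ^+ 2 :> 'Z_4.
  by apply/eqP; rewrite -subr_eq0 -!sqr -(cstM (B ^+ 2)) -rmorphB e1; apply/eqP; exact: mod4_mul4.
have /mod4_even[D' hD] : 2 * (C - E)%:~R = 0 :> 'Z_4.
  rewrite rmorphB; apply: (mod4_relative1 d1 dxz AB2).
    apply/eqP; rewrite -subr_eq0 -!sqr -(cstM (B ^+ 2)) -!cst -!rmorphD -cst -rmorphB e2.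
    have -> : 8 * F = 4 * (2 * F) by lia.
    by apply/eqP; exact: mod4_mul4.
  apply/eqP; rewrite -subr_eq0 -!rmorphM -cst -rmorphB e3.
  by apply/eqP; exact: mod4_mul4.
split.
- by apply/intrP; exists E.
- apply/intrP; exists D'; have : (C - E)%:~R = 2 * D'%:~R :> rat by rewrite hD rmorphM.
  by rewrite rmorphB /= -eC -eE; lra.
move=> c0 e0.
have C0 : C = 0 by apply: (@intr_inj rat); rewrite -eC c0 mulr0.
have E0 : E = 0 by apply: (@intr_inj rat); rewrite -eE e0 mulr0.
rewrite C0 E0 in e2; rewrite C0 in e3.
have [d ed] : exists d : int, (x * y)%:Z = 1 + 4 * d.
  have [|d ed] := @mod4_eq0 ((x * y)%:Z - 1); last by exists d; lia.
  by rewrite rmorphB /= -pmulrn natrM d1 subrr.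
rewrite ed in e1 e2.
have [n' hn] : exists n' : int, n%:Z = 2 * n' + 1 by exists (n./2)%:Z; lia.
have [||| A' [B' [m [hA hB em]]]] := @quadratic_parity A B n' d k F G.
- by rewrite -e1.
- by rewrite -e2; ring.
- by rewrite -e3; ring.
rewrite -hn in em.
split; apply/intrP.
- by exists B'; move: eB; rewrite hB rmorphM /=; lra.
- exists m; have : (A' - n%:Z * B')%:~R = 2 * m%:~R :> rat by rewrite em rmorphM.
  rewrite rmorphB rmorphM /= -pmulrn => h.
  have ha : 2 * a = A'%:~R by move: eA; rewrite hA rmorphM /=; lra.
  have hb : 2 * b = B'%:~R by move: eB; rewrite hB rmorphM /=; lra.
  by rewrite -ha -hb in h; lra.
Qed.

(** Here [c] is the coefficient of [sqrt 3]. Its integrality makes [2 H] an integer, so that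
    [k = 2 < 3 = z] is available. *)
Lemma tri_Aint_special (sx sy sz : algC) (a b c e : rat) :
  admissible 1 2 3 ->
  sx ^+ 2 = 1%:R -> sy ^+ 2 = 2%:R -> sz ^+ 2 = 3%:R ->
  tri sx sy sz a b c e \in Aint -> c \is a Num.int.
Proof.
move=> adm ex ey ez /(tri_Aint_halves adm isT ex ey ez).
move=> [A [B [C [E [F [G [[_ _ eC _] [e1 e2]]]]]]]].
have [|C' hC] := @mod4_even C; last first.
  by apply/intrP; exists C'; move: eC; rewrite hC rmorphM /=; lra.
apply: (@mod4_special A%:~R B%:~R C%:~R E%:~R).
  rewrite -(mod4_mul4 (F + C ^+ 2 + 2 * E ^+ 2)).
  rewrite (_ : 4 * _ = A ^+ 2 + 2%:Z * B ^+ 2 + C ^+ 2 + 2%:Z * E ^+ 2); last by lra.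
  by rewrite !intrD !intrM.
rewrite -(mod4_mul4 G) (_ : 4 * G = 2%:Z * (A * B - 3%:Z * (C * E))); last by lra.
by rewrite intrM intrB !intrM.
Qed.

(** * Elements not represented by a form *)

Lemma qformZ (R : comNzRingType) r (A : 'I_r -> 'I_r -> int) (k : R) (u : 'I_r -> R) :
  qform A (fun i => k * u i) = k ^+ 2 * qform A u.
Proof.
rewrite /qform mulr_sumr; apply: eq_bigr => i _; rewrite mulr_sumr.
by apply: eq_bigr => j _; ring.
Qed.

Lemma polarZ (R : comNzRingType) r (A : 'I_r -> 'I_r -> int) (k l : R) (u w : 'I_r -> R) :
  polar A (fun i => k * u i) (fun i => l * w i) = k * l * polar A u w.
Proof.
rewrite /polar mulr_sumr; apply: eq_bigr => i _; rewrite mulr_sumr.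
by apply: eq_bigr => j _; ring.
Qed.

Lemma polarZr (R : comNzRingType) r (A : 'I_r -> 'I_r -> int) (k : R) (u w : 'I_r -> R) :
  polar A u (fun i => k * w i) = k * polar A u w.
Proof.
rewrite /polar mulr_sumr; apply: eq_bigr => i _; rewrite mulr_sumr.
by apply: eq_bigr => j _; ring.
Qed.

Lemma tri_sum (I : Type) (s : seq I) (P : pred I) (sx sy sz : algC) (a b c e : I -> rat) :
  \sum_(i <- s | P i) tri sx sy sz (a i) (b i) (c i) (e i) =
  tri sx sy sz (\sum_(i <- s | P i) a i) (\sum_(i <- s | P i) b i)
    (\sum_(i <- s | P i) c i) (\sum_(i <- s | P i) e i).
Proof.
by rewrite /tri !rmorph_sum /= !mulr_suml -!big_split.
Qed.

Lemma Zform_tri (x y z : nat) r (A : 'I_r -> 'I_r -> int) (v : 'I_r -> algC)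
    (sx sy sz : algC) (a b c e : 'I_r -> rat) :
  sx ^+ 2 = x%:R -> sy ^+ 2 = y%:R -> sz ^+ 2 = z%:R ->
  (forall i, v i = tri sx sy sz (a i) (b i) (c i) (e i)) ->
  Zform_eval A v = tri sx sy sz
    (qform A a + x%:R * y%:R * qform A b + z%:R * (x%:R * qform A c + y%:R * qform A e))
    (polar A a b + z%:R * polar A c e)
    (polar A a c + y%:R * polar A b e)
    (polar A a e + x%:R * polar A b c).
Proof.
move=> ex ey ez ev.
have termE i j : (A i j)%:~R * v i * v j = tri sx sy sz
    ((A i j)%:~R * (a i * a j) + x%:R * y%:R * ((A i j)%:~R * (b i * b j)) +
       z%:R * (x%:R * ((A i j)%:~R * (c i * c j)) + y%:R * ((A i j)%:~R * (e i * e j))))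
    ((A i j)%:~R * (a i * b j + b i * a j) + z%:R * ((A i j)%:~R * (c i * e j + e i * c j)))
    ((A i j)%:~R * (a i * c j + c i * a j) + y%:R * ((A i j)%:~R * (b i * e j + e i * b j)))
    ((A i j)%:~R * (a i * e j + e i * a j) + x%:R * ((A i j)%:~R * (b i * c j + c i * b j))).
  rewrite !ev -mulrA (triM _ _ _ _ _ _ _ _ ex ey ez).
  by rewrite /tri !(rmorphD, rmorphM) /= !ratr_nat !ratr_int; ring.
rewrite /Zform_eval; under eq_bigr do (under eq_bigr do rewrite termE; rewrite tri_sum).
rewrite tri_sum /qform /polar; congr tri; rewrite !mulr_sumr -!big_split ?mulr_sumr -?big_split;
  apply: eq_bigr => i _ /=; rewrite !mulr_sumr -!big_split ?mulr_sumr -?big_split;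
  by apply: eq_bigr.
Qed.

Lemma sqrt_bounds (d : nat) : (1 < d)%N -> squarefreen d ->
  exists n : nat, (n * n < d < n.+1 * n.+1)%N.
Proof.
move=> d1 sqf.
have [n /andP[h1 h2]] : exists n, (n * n <= d < n.+1 * n.+1)%N.
  elim: d {d1 sqf} => [|d [n IH]]; first by exists 0%N.
  have [h|h] := ltnP d.+1 (n.+1 * n.+1); first by exists n; lia.
  by exists n.+1; lia.
exists n; rewrite h2 andbT ltn_neqAle h1 andbT; apply/eqP => e.
by have n1 : n = 1%N by [apply: sqf; rewrite e]; rewrite n1 in e; lia.
Qed.

(** If the integer part of the root is even, its predecessor is taken, whence the window of width
    2. *)
Lemma odd_sqrt_bounds (d : nat) : (1 < d)%N -> squarefreen d -> (d %% 4 = 1)%N ->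
  exists n : nat, odd n /\ (n * n < d < n.+2 * n.+2)%N.
Proof.
move=> d1 sqf d4; have [n /andP[h1 h2]] := sqrt_bounds d1 sqf.
case: (boolP (odd n)) => on; first by exists n; split=> //; lia.
have [n0|n0] := posnP n; first by rewrite n0 in h2; lia.
by exists n.-1; split; [lia | case: n h1 h2 n0 {on} => // n /=; lia].
Qed.

(** Units modulo 4 are their own inverses. *)
Lemma mul_eq1_mod4 (x y : nat) : (x * y)%:R = 1 :> 'Z_4 ->
  (x %% 4 = y %% 4)%N /\ odd x /\ (x * y %% 4 = 1)%N.
Proof.
move=> /(congr1 val); rewrite /= val_Zp_nat // => e.
have {}e : (x * y %% 4 = 1)%N by [].
have : (x %% 4 * (y %% 4) %% 4 = 1)%N by rewrite modnMml modnMmr.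
have oddE : odd x = odd (x %% 4) by rewrite {1}(divn_eq x 4) oddD oddM andbF.
rewrite oddE e; have : (x %% 4 < 4)%N by rewrite ltn_mod.
have : (y %% 4 < 4)%N by rewrite ltn_mod.
by move: (x %% 4)%N (y %% 4)%N => [|[|[|[|//]]]] [|[|[|[|//]]]].
Qed.

Lemma tri_not_represented (x y z n t : nat) r (A : 'I_r -> 'I_r -> int) (v : 'I_r -> algC)
    (sx sy sz : algC) :
  admissible x y z -> (5 <= z)%N \/ [/\ x = 1, y = 2 & z = 3]%N ->
  sx ^+ 2 = x%:R -> sy ^+ 2 = y%:R -> sz ^+ 2 = z%:R ->
  (n * n < x * y)%N ->
  (t = 1%N /\ x%:R * y%:R != 1 :> 'Z_4) \/
  [/\ t = 2%N, odd n, x%:R * y%:R = 1 :> 'Z_4 & (x * y)%N <> 5%N] ->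
  posdef A ->
  (forall i, v i \in Aint /\ exists a b c e : rat, v i = tri sx sy sz a b c e) ->
  Zform_eval A v <> tri sx sy sz ((n + t)%:R / t%:R) (t%:R^-1) 0 0.
Proof.
move=> adm hz ex ey ez nd ht pA hv ev.
have [u hu] : exists u : 'I_r -> rat * rat * rat * rat,
    forall i, v i = tri sx sy sz (u i).1.1.1 (u i).1.1.2 (u i).1.2 (u i).2.
  apply: (@fin_all_exists _ _ (fun i w => v i = tri sx sy sz w.1.1.1 w.1.1.2 w.1.2 w.2)) => i.
  by have [_ [a [b [c [e h]]]]] := hv i; exists (a, b, c, e).
have vA i : tri sx sy sz (u i).1.1.1 (u i).1.1.2 (u i).1.2 (u i).2 \in Aint.
  by rewrite -hu; case: (hv i).
move: ev; rewrite (Zform_tri A ex ey ez hu).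
set a := fun i => (u i).1.1.1 in vA *; set b := fun i => (u i).1.1.2 in vA *.
set c := fun i => (u i).1.2 in vA *; set e := fun i => (u i).2 in vA *.
move=> /(tri_inj adm ex ey ez)[e1 e2 _ _].
have [[xy xz yz] _] := adm.
have x0 : 0 < x%:R :> rat by rewrite ltr0n; lia.
have dn : n%:R ^+ 2 < x%:R * y%:R :> rat by rewrite -natrX -natrM ltr_nat -mulnn.
have z5 : (5 <= z)%N -> 4 < z%:R :> rat by rewrite (ltr_nat _ 4).
case: ht => [[t1 d1]|[t2 on d1 d5]].
  have H := fun i => tri_Aint_not1mod4 adm d1 ex ey ez (vA i).
  have c2 i : 2 * c i \is a Num.int by have [] := H i.
  have e2i i : 2 * e i \is a Num.int by have [] := H i.
  have t10 : 0 < t%:R :> rat by rewrite t1.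
  (* [k = 4] clears the denominators of the half-integral [c] and [e]. For [(1, 2, 3)] the vector
     [c] is integral and [y = 2] supplies the missing factor at [e], so [k = 2] suffices. *)
  have [k [k0 kz kH]] : exists k : rat, [/\ 0 < k, k < z%:R &
      k * (x%:R * qform A c + y%:R * qform A e - n%:R * polar A c e) \is a Num.int].
    case: hz => [/z5 z4|[x1 y2 z3]].
      exists 4; split=> //.
      have -> : 4 * (x%:R * qform A c + y%:R * qform A e - n%:R * polar A c e) =
        x%:R * qform A (fun i => 2 * c i) + y%:R * qform A (fun i => 2 * e i)
        - n%:R * polar A (fun i => 2 * c i) (fun i => 2 * e i).
        by rewrite !qformZ polarZ; ring.
      by rewrite rpredB ?rpredD ?rpredM ?rpred_nat ?qform_int ?polar_int.
    exists 2; split; rewrite ?z3 ?(ltr_nat _ 2) //.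
    have ci i : c i \is a Num.int.
      by move: (vA i) adm ex ey ez; rewrite x1 y2 z3 => vi adm' ex' ey' ez';
         exact: (tri_Aint_special adm' ex' ey' ez' vi).
    have -> : 2 * (x%:R * qform A c + y%:R * qform A e - n%:R * polar A c e) =
      2 * x%:R * qform A c + qform A (fun i => 2 * e i)
      - n%:R * polar A (fun i => 1 * c i) (fun i => 2 * e i).
      by rewrite !qformZ polarZ y2; ring.
    rewrite rpredB ?rpredD ?rpredM ?rpred_nat ?qform_int ?polar_int // => i.
    by rewrite mul1r.
  apply: (@no_representation r A x%:R y%:R z%:R n%:R t%:R k a b c e) => //.
  - by rewrite t1 expr1n divr1 -natrX -natrM rpredB ?rpred_nat.
  - by rewrite t1 -natrM => -[/eqP]; rewrite eqr_nat; lia.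
  - move=> c0 e0 i; have [_ _ /(_ (c0 i) (e0 i))[ai bi]] := H i.
    by rewrite t1 mul1r rpredB ?rpredM ?rpred_nat.
  - by rewrite e1 natrD.
have H := fun i => tri_Aint_1mod4 adm d1 on ex ey ez (vA i).
have e4 i : 4 * e i \is a Num.int by have [] := H i.
have ce2 i : 2 * (c i - e i) \is a Num.int by have [] := H i.
have t20 : 0 < t%:R :> rat by rewrite t2.
have {}hz : (5 <= z)%N by case: hz => // -[x1 y2 _]; move: d1; rewrite x1 y2.
have [xy4 [ox xy1]] : (x %% 4 = y %% 4)%N /\ odd x /\ (x * y %% 4 = 1)%N.
  by apply: mul_eq1_mod4; rewrite natrM.
have Hint : 4 * (x%:R * qform A c + y%:R * qform A e - n%:R * polar A c e) \is a Num.int.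
  (* Rewriting in the integral vectors [2 (c - e)] and [4 e]. The coefficients are integers because
     [x] and [y] agree modulo 4 and [x], [n] are odd. *)
  have -> : 4 * (x%:R * qform A c + y%:R * qform A e - n%:R * polar A c e) =
    x%:R * qform A (fun i => 2 * (c i - e i))
    + (x%:R + y%:R - 2 * n%:R) / 4 * qform A (fun i => 4 * e i)
    + (x%:R - n%:R) / 2 * polar A (fun i => 2 * (c i - e i)) (fun i => 4 * e i).
    have uE i : 2 * (c i - e i) = 2 * c i + (- 2) * e i by ring.
    rewrite (eq_qform _ uE) (eq_polar _ _ uE) qformZ qform_lin polar_lin !polarZr polarxx.
    by field.
  have xyn : (x%:R + y%:R - 2 * n%:R) / 4 \is a @Num.int rat.
    have [m em] : exists m : int, x%:Z + y%:Z - 2 * n%:Z = 4 * m.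
      by exists ((x%:Z + y%:Z - 2 * n%:Z) %/ 4)%Z; lia.
    apply/intrP; exists m; move: em => /(congr1 (intr : int -> rat)).
    by rewrite intrB intrD !intrM -!pmulrn; lra.
  have xn : (x%:R - n%:R) / 2 \is a @Num.int rat.
    have [m em] : exists m : int, x%:Z - n%:Z = 2 * m.
      by exists ((x%:Z - n%:Z) %/ 2)%Z; lia.
    apply/intrP; exists m; move: em => /(congr1 (intr : int -> rat)).
    by rewrite intrB intrM -!pmulrn; lra.
  by rewrite !rpredD // rpredM ?rpred_nat ?qform_int ?polar_int.
apply: (@no_representation r A x%:R y%:R z%:R n%:R t%:R 4 a b c e) => //.
- exact: z5.
- have [m em] : exists m : int, (x * y)%:Z - n%:Z * n%:Z = 4 * m.
    have [n' hn] : exists n' : int, n%:Z = 2 * n' + 1 by clear - on; exists (n./2)%:Z; lia.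
    have [d hd] : exists d : int, (x * y)%:Z = 4 * d + 1.
      by clear - xy1; exists ((x * y) %/ 4)%N%:Z; lia.
    by exists (d - n' * n' - n'); rewrite hn hd; ring.
  apply/intrP; exists m; move: em => /(congr1 (intr : int -> rat)).
  by rewrite t2 intrB !intrM -!pmulrn natrM; lra.
(* With [t = 2] the excluded case reads [n = 1] and [x y = 1 + 4 = 5]. *)
- rewrite t2 => -[h1 h2]; apply: d5; apply/eqP; rewrite -(eqr_nat rat) natrM h2.
  by have -> : n%:R = 1 :> rat by lra.
- move=> c0 e0 i; have [_ _ /(_ (c0 i) (e0 i))[ai bi]] := H i.
  by rewrite t2.
by rewrite e1 natrD.
Qed.

(** * Choice of the quadratic subfield *)

(** Free of [n] and [t], hence invariant under permutations of [x], [y], [z]. The eight sign choices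
    of the square roots give each of the four embeddings twice. *)
Definition obstructed (x y z : nat) : Prop :=
  exists a b c e : rat, let alpha := tri (sqrtC x%:R) (sqrtC y%:R) (sqrtC z%:R) a b c e in
  [/\ alpha \in Aint,
      forall sx sy sz : algC, sx ^+ 2 = x%:R -> sy ^+ 2 = y%:R -> sz ^+ 2 = z%:R ->
        0 < tri sx sy sz a b c e &
      forall r (A : 'I_r -> 'I_r -> int) (v : 'I_r -> algC), posdef A ->
        (forall i, v i \in Aint /\
          exists a b c e, v i = tri (sqrtC x%:R) (sqrtC y%:R) (sqrtC z%:R) a b c e) ->
        Zform_eval A v <> alpha].

Lemma tri_swap12 (sx sy sz : algC) (a b c e : rat) : tri sx sy sz a b c e = tri sy sx sz a b e c.
Proof. by rewrite /tri; ring. Qed.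

Lemma tri_swap23 (sx sy sz : algC) (a b c e : rat) : tri sx sy sz a b c e = tri sx sz sy a c b e.
Proof. by rewrite /tri; ring. Qed.

Lemma obstructed_swap12 (x y z : nat) : obstructed x y z -> obstructed y x z.
Proof.
move=> [a [b [c [e [h1 h2 h3]]]]]; exists a, b, e, c; rewrite -tri_swap12; split=> //.
  by move=> sx sy sz ex ey ez; rewrite -tri_swap12; apply: h2.
move=> r A v pA hv; apply: h3 => // i; have [vA [a' [b' [c' [e' h]]]]] := hv i.
by split=> //; exists a', b', e', c'; rewrite -tri_swap12.
Qed.

Lemma obstructed_swap23 (x y z : nat) : obstructed x y z -> obstructed x z y.
Proof.
move=> [a [b [c [e [h1 h2 h3]]]]]; exists a, c, b, e; rewrite -tri_swap23; split=> //.
  by move=> sx sy sz ex ey ez; rewrite -tri_swap23; apply: h2.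
move=> r A v pA hv; apply: h3 => // i; have [vA [a' [b' [c' [e' h]]]]] := hv i.
by split=> //; exists a', c', b', e'; rewrite -tri_swap23.
Qed.

Lemma quadratic_Aint (T N : int) (u : algC) : u ^+ 2 = T%:~R * u - N%:~R -> u \in Aint.
Proof.
move=> e; apply: (@root_monic_Aint ('X^2 - (T%:~R *: 'X - (N%:~R)%:P))).
- by apply/rootP; rewrite !hornerE e subrr.
- rewrite monicE lead_coefDl ?lead_coefXn // size_polyXn size_polyN.
  rewrite (leq_ltn_trans (size_polyD _ _)) // size_polyN gtn_max.
  by rewrite (leq_ltn_trans (size_scale_leq _ _)) ?size_polyX // (leq_ltn_trans (size_polyC_leq1 _)).
- apply/polyOverP => i; rewrite !coefE.
  by case: (i == 0)%N; rewrite !rpredB ?rpredM ?rpred_int ?rpred_nat ?rpred0.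
Qed.

Lemma obstructed_intro (x y z n t : nat) :
  admissible x y z -> (5 <= z)%N \/ [/\ x = 1, y = 2 & z = 3]%N ->
  (n * n < x * y < (n + t) * (n + t))%N ->
  (t = 1%N /\ x%:R * y%:R != 1 :> 'Z_4) \/
  [/\ t = 2%N, odd n, x%:R * y%:R = 1 :> 'Z_4 & (x * y)%N <> 5%N] ->
  obstructed x y z.
Proof.
move=> adm hz /andP[n1 n2] ht.
have t0 : t%:R != 0 :> algC by case: ht => [[->]|[->]] //; rewrite pnatr_eq0.
exists ((n + t)%:R / t%:R), (t%:R^-1), 0, 0; split; last first.
- move=> r A v pA hv; apply: (tri_not_represented adm hz) pA hv; rewrite ?sqrtCK //.
- move=> sx sy sz ex ey _.
  have realP (w : algC) k : w ^+ 2 = k%:R -> w \is Num.real.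
    move=> ew; have : (sqrtC k%:R) ^+ 2 == w ^+ 2 by rewrite sqrtCK ew.
    rewrite eqf_sqr => /orP[] /eqP h; last rewrite -[w]opprK -h realN.
      by rewrite -h realE sqrtC_ge0 ler0n.
    by rewrite realE sqrtC_ge0 ler0n.
  (* Positivity amounts to [- (sx * sy) < n + t], which follows by comparing squares. *)
  have sr : - (sx * sy) \is Num.real by rewrite realN realM ?(realP sx x) ?(realP sy y).
  have s2 : (- (sx * sy)) ^+ 2 < (n + t)%:R ^+ 2 :> algC.
    by rewrite sqrrN exprMn ex ey -natrM -natrX ltr_nat -mulnn.
  have slt : - (sx * sy) < (n + t)%:R.
    rewrite real_ltNge ?realn //; apply/negP => h.
    suff /(lt_le_trans s2) : (n + t)%:R ^+ 2 <= (- (sx * sy)) ^+ 2 by rewrite ltxx.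
    by rewrite ler_sqr // nnegrE ?(le_trans _ h) ?ler0n.
  have -> : tri sx sy sz ((n + t)%:R / t%:R) t%:R^-1 0 0 = ((n + t)%:R - - (sx * sy)) / t%:R.
    by rewrite /tri fmorph_div fmorphV /= !ratr_nat rmorph0; ring.
  by rewrite divr_gt0 ?subr_gt0 // lt0r t0 ler0n.
(* [m] is the norm of the element over Q in the quadratic subfield and [T] below its trace. For
   [t = 2] both [(n + 2)^2] and [x y] are 1 modulo 4. *)
have [m em] : exists m : int, (n + t)%:Z * (n + t)%:Z - (x * y)%:Z = t%:Z * t%:Z * m.
  case: ht => [[-> _]|[-> on d1 _]]; first by exists ((n + 1)%:Z * (n + 1)%:Z - (x * y)%:Z); ring.
  have [_ [_ xy1]] : (x %% 4 = y %% 4)%N /\ odd x /\ (x * y %% 4 = 1)%N.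
    by apply: mul_eq1_mod4; rewrite natrM.
  have [n' hn] : exists n' : int, (n + 2)%:Z = 2 * n' + 1 by clear - on; exists ((n + 2)./2)%:Z; lia.
  have [d hd] : exists d : int, (x * y)%:Z = 4 * d + 1.
    by clear - xy1; exists ((x * y) %/ 4)%N%:Z; lia.
  by exists (n' * n' + n' - d); rewrite hn hd; ring.
have [T eT] : exists T : nat, (2 * (n + t) = t * T)%N.
  by case: ht => [[-> _]|[-> _ _ _]]; [exists (2 * (n + 1))%N | exists (n + 2)%N]; lia.
apply: (@quadratic_Aint T%:Z m).
have eT' : 2 * (n + t)%:R = t%:R * T%:R :> algC by rewrite -!natrM eT.
have em' : (n + t)%:R * (n + t)%:R - x%:R * y%:R = t%:R * t%:R * m%:~R :> algC.
  by move: em => /(congr1 (intr : int -> algC)); rewrite intrB !intrM -!pmulrn natrM.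
have -> : m%:~R = ((n + t)%:R * (n + t)%:R - x%:R * y%:R) / (t%:R * t%:R) :> algC.
  by rewrite em' mulrC mulKf // mulf_neq0.
have -> : T%:Z%:~R = 2 * (n + t)%:R / t%:R :> algC.
  by rewrite eT' mulrC mulKf.
rewrite /tri fmorph_div fmorphV /= !ratr_nat rmorph0.
have := sqrtCK (x%:R : algC); have := sqrtCK (y%:R : algC).
move: (sqrtC x%:R) (sqrtC y%:R) => sx sy <- <-.
by field.
Qed.

Lemma admissible_swap12 (x y z : nat) : admissible x y z -> admissible y x z.
Proof. by move=> [[h1 h2 h3] [h4 h5 h6]]; split; split=> //; rewrite mulnC. Qed.

Lemma admissible_swap23 (x y z : nat) : admissible x y z -> admissible x z y.
Proof. by move=> [[h1 h2 h3] [h4 h5 h6]]; split; split=> //; rewrite mulnC. Qed.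

Lemma admissible_neq12 (x y z : nat) : admissible x y z -> x <> y.
Proof.
by move=> [[h _ _] [sq _ _]] e; have x1 : x = 1%N by [apply: sq; rewrite e]; subst x y.
Qed.

Lemma obstructed_large (x y z : nat) :
  admissible x y z -> (5 <= z)%N -> (x * y)%N <> 5%N -> obstructed x y z.
Proof.
move=> adm z5 d5; have [[xy _ _] [sqf _ _]] := adm.
have [d1|d1] := eqVneq (x%:R * y%:R : 'Z_4) 1.
  have [_ [_ d14]] : (x %% 4 = y %% 4)%N /\ odd x /\ (x * y %% 4 = 1)%N.
    by apply: mul_eq1_mod4; rewrite natrM.
  have [n [on nn]] := odd_sqrt_bounds xy sqf d14.
  by apply: (@obstructed_intro x y z n 2) => //; [left | rewrite addn2 | right].
have [n nn] := sqrt_bounds xy sqf.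
by apply: (@obstructed_intro x y z n 1) => //; [left | rewrite addn1 | left].
Qed.

Lemma obstructed_sorted (x y z : nat) :
  admissible x y z -> (x < y)%N -> (y < z)%N -> obstructed x y z.
Proof.
move=> adm xy yz; have [[x1 _ _] [_ _ sqf]] := adm.
have [z5|z5] := leqP 5 z.
  have [d5|/eqP d5] := eqVneq (x * y)%N 5%N; last exact: obstructed_large.
  have hx : x = 1%N.
    have [x2|x2] := leqP 2 x; last by case: x x1 {adm xy d5} x2 => [|[|]].
    by have := leq_mul x2 (leq_ltn_trans x2 xy); rewrite d5.
  (* The triple is [(1, 5, z)] with [z > 5]; after the exchange the radicand is [z] and the third
     entry is 5. *)
  subst x; rewrite mul1n in d5; subst y.
  apply: obstructed_swap23; apply: obstructed_large; rewrite ?mul1n //; last by lia.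
  exact: admissible_swap23.
(* Squarefreeness of [y z] excludes [z = 4], so only [(1, 2, 3)] is left; there [n = t = 1], as
   [1 < 2 < 4]. *)
have z4 : z <> 4%N.
  by move=> z4; have := sqf 2%N; rewrite z4 dvdn_mull // => /(_ isT).
have x0 : (0 < x)%N by case: x x1 {adm xy}.
have [hx [hy hz]] : x = 1%N /\ y = 2%N /\ z = 3%N by lia.
apply: (@obstructed_intro x y z 1 1) => //; first by right.
  by rewrite hx hy.
by left; rewrite hx hy.
Qed.

Lemma admissible_obstructed (x y z : nat) : admissible x y z -> obstructed x y z.
Proof.
suff main u v w : admissible u v w -> (u < v)%N -> obstructed u v w.
  move=> adm; have := admissible_neq12 adm => /eqP; rewrite neq_ltn => /orP[h|h].
    exact: main.
  by apply: obstructed_swap12; apply: main => //; apply: admissible_swap12.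
move=> adm uv.
have adm' := admissible_swap23 adm.
have /eqP := admissible_neq12 adm'; rewrite neq_ltn => /orP[uw|wu]; last first.
  apply: obstructed_swap23; apply: obstructed_swap12.
  by apply: obstructed_sorted => //; apply: admissible_swap12.
have /eqP := admissible_neq12 (admissible_swap23 (admissible_swap12 adm)).
rewrite neq_ltn => /orP[vw|wv]; first exact: obstructed_sorted.
by apply: obstructed_swap23; apply: obstructed_sorted.
Qed.

(** * Reduction of [p], [q] to an admissible triple *)

Lemma squarefreen_dvd (d m : nat) : (d %| m)%N -> squarefreen m -> squarefreen d.
Proof. by move=> dm sqf k kd; apply: sqf; apply: dvdn_trans dm. Qed.

(** A prime whose square divides the product divides one factor and is coprime to the other, so its
    square divides the first. *)
Lemma squarefreenM (m n : nat) :
  coprime m n -> squarefreen m -> squarefreen n -> squarefreen (m * n).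
Proof.
move=> cop sm sn d dd; apply/eqP/negPn/negP => d1.
have pr := pdiv_prime (_ : 1 < d)%N.
(* [d = 0] would make a factor 0, which is not squarefree since 4 divides it. *)
have {d1} d1 : (1 < d)%N by case: d dd d1 {pr} => [|[|]] //; rewrite dvd0n muln_eq0;
  move=> /orP[] /eqP h _; [have := sm 2%N | have := sn 2%N]; rewrite h dvdn0 => /(_ isT).
have {}pr := pr d1; set l := pdiv d in pr.
have ll : (l * l %| m * n)%N by apply: dvdn_trans dd; rewrite dvdn_mul ?pdiv_dvd.
have aux a b : coprime a b -> squarefreen a -> (l * l %| a * b)%N -> (l %| a)%N -> False.
  move=> cab sa lab la.
  have cl : coprime l b := coprime_dvdl la cab.
  have : (l * l %| a)%N by rewrite -(@Gauss_dvdl (l * l) a b) // coprimeMl cl.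
  by move=> /sa l1; rewrite l1 in pr.
have : (l %| m * n)%N by apply: dvdn_trans ll; apply: dvdn_mulr.
rewrite (Euclid_dvdM _ _ pr) => /orP[] h; first exact: (aux m n).
by apply: (aux n m) => //; rewrite 1?coprime_sym 1?mulnC // mulnC.
Qed.

Theorem theorem5p2 (p q : nat) :
  (1 < p)%N -> (1 < q)%N -> p <> q -> squarefreen p -> squarefreen q ->
  forall (r : nat) (A : 'I_r -> 'I_r -> int),
    posdef A -> ~ universal_OK p q A.
Proof.
move=> p1 q1 pq sp sq r A pA univ.
have g0 : (0 < gcdn p q)%N by rewrite gcdn_gt0; lia.
have [p' ep] : exists p', p = (gcdn p q * p')%N.
  by have /dvdnP[p' h] := dvdn_gcdl p q; exists p'; rewrite mulnC.
have [q' eq] : exists q', q = (gcdn p q * q')%N.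
  by have /dvdnP[q' h] := dvdn_gcdr p q; exists q'; rewrite mulnC.
set g := gcdn p q in g0 ep eq.
have cop : coprime p' q'.
  rewrite /coprime -(eqn_pmul2l g0) muln_gcdr -ep -eq muln1 //.
have adm : admissible g p' q'.
  split; split; rewrite -?ep -?eq //.
    (* [p' = q' = 1] would give [p = q]. *)
    case: p' q' ep eq cop => [|[|p']] [|[|q']] ep eq cop; lia.
  apply: squarefreenM => //.
    by apply: squarefreen_dvd sp; rewrite {1}ep dvdn_mull.
  by apply: squarefreen_dvd sq; rewrite {1}eq dvdn_mull.
have [a [b [c [e [aA apos anot]]]]] := admissible_obstructed adm.
have sgE (k : nat) : sqrtC (g * k)%:R = sqrtC g%:R * sqrtC k%:R :> algC.
  by rewrite natrM sqrtCM // nnegrE ler0n.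
(* Since [sqrt p sqrt q = g sqrt (p' q')], the last coordinate is scaled by [g]; the signs of the
   embedding are carried by the roots of [p'] and [q']. *)
have bqE s t (a' b' c' d' : rat) : bqelt p q s t a' b' c' d' =
    tri (sqrtC g%:R) ((-1) ^+ s * sqrtC p'%:R) ((-1) ^+ t * sqrtC q'%:R) a' b' c' (g%:R * d').
  rewrite /bqelt /tri {1 2}ep {1 2}eq !sgE rmorphM /= ratr_nat.
  have := sqrtCK (g%:R : algC); move: (sqrtC g%:R) => sg <-.
  by ring.
have bqE1 a' b' c' d' : bqelt p q false false a' b' c' d' =
    tri (sqrtC g%:R) (sqrtC p'%:R) (sqrtC q'%:R) a' b' c' (g%:R * d').
  by rewrite bqE expr0 !mul1r.
have gq0 : g%:R != 0 :> rat by rewrite pnatr_eq0 -lt0n.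
have geK : g%:R * (e / g%:R) = e by rewrite mulrC divfK.
have [|| v [vO vE]] := univ (tri (sqrtC g%:R) (sqrtC p'%:R) (sqrtC q'%:R) a b c e).
- by split=> //; exists a, b, c, (e / g%:R); rewrite bqE1 geK.
- exists a, b, c, (e / g%:R); split=> [|s t]; first by rewrite bqE1 geK.
  by rewrite bqE geK apos // ?exprMn ?sqrtCK // sqrr_sign mul1r.
apply: (anot _ _ _ pA _ vE) => i; have [[a' [b' [c' [d' h]]]] vA] := vO i.
by split=> //; exists a', b', c', (g%:R * d'); rewrite h bqE1.
Qed.
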